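(* Let $\mathcal{H}$ be a complex Hilbert space and let $A\in \mathcal{B}(\mathcal{H})$. Then: (i) $w(A)=\frac{1}{2}\|A\|$ if and only if $W(A)$ is a circular disk with center at the origin and radius $\frac{1}{2}\|A\|$. (ii) $w(A)=\frac{1}{2}\sqrt{\|A^*A+AA^*\|}$ if and only if $W(A)$ is a circular disk with center at the origin and radius $\frac{1}{2}\sqrt{\|A^*A+AA^*\|}$.
   Context: $\mathcal{B}(\mathcal{H})$ denotes the algebra of all bounded linear operators on the complex Hilbert space $\mathcal{H}$, with operator norm $\|\cdot\|$ and adjoint $A^*$. The numerical range is $W(A)=\{\langle Ax,x\rangle : x\in\mathcal{H},\ \|x\|=1\}\subseteq\mathbb{C}$ and the numerical radius is $w(A)=\sup\{|\langle Ax,x\rangle| : x\in\mathcal{H},\ \|x\|=1\}$. The space $\mathcal{H}$ may be infinite-dimensional, so $W(A)$ need be neither open nor closed. ''Circular disk with center at the origin and radius $k$'' means a convex set bounded by the circle $|z|=k$, with no requirement on which boundary points belong to it; i.e. a set $D$ with $\{z\in\mathbb{C}:|z|<k\}\subseteq D\subseteq\{z\in\mathbb{C}:|z|\le k\}$ (for $k=0$, $D=\{0\}$). *)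

(* Defs.v *)
From HB Require Import structures.
From mathcomp Require Import all_boot all_order all_algebra.
From mathcomp Require Import sesquilinear complex.
From mathcomp Require Import all_classical all_reals all_analysis.

Set Implicit Arguments.
Unset Strict Implicit.
Unset Printing Implicit Defensive.

Import Order.TTheory GRing.Theory Num.Theory.
Import numFieldNormedType.Exports.
Local Open Scope classical_set_scope.
Local Open Scope ring_scope.
Local Open Scope complex_scope.

(* Linear in the first argument, conjugate-linear in the second.  Norms on a
   module over [R[i]] are themselves [R[i]]-valued. *)
HB.mixin Record CompleteNormedModule_isHilbert (R : realType) H
    of CompleteNormedModule R[i] H := {
  inner : H -> H -> R[i] ;
  innerDZl : forall (a : R[i]) (x y z : H),
    inner (a *: x + y) z = a * inner x z + inner y z ;
  innerC : forall x y : H, inner y x = (inner x y)^*%R ;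
  inner_normE : forall x : H, inner x x = `|x| ^+ 2
}.

#[short(type="hilbertType")]
HB.structure Definition Hilbert (R : realType) :=
  { H of CompleteNormedModule_isHilbert R H & CompleteNormedModule R[i] H }.

Section InnerDot.
Variables (R : realType) (H : hilbertType R).
Implicit Types x y z : H.

Lemma inner_linearl y : linear_for *%R (@inner R H ^~ y).
Proof. by move=> a x z; exact: innerDZl. Qed.

Lemma inner_linearr x : linear_for (Num.Def.conjC \; *%R) (@inner R H x).
Proof.
by move=> a y z /=; rewrite ![inner x _]innerC innerDZl rmorphD rmorphM.
Qed.

HB.instance Definition _ := @bilinear_isBilinear.Build R[i] H H R[i]
  *%R (Num.Def.conjC \; *%R) (@inner R H) (inner_linearl, inner_linearr).

Lemma inner_hermitian x y :
  inner x y = (-1) ^+ false * Num.Def.conjC (inner y x).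
Proof. by rewrite expr0 mul1r innerC. Qed.

HB.instance Definition _ := @isHermitianSesquilinear.Build R[i] H false
  Num.Def.conjC (@inner R H) inner_hermitian.

Lemma inner_gt0 x : x != 0 -> 0 < inner x x.
Proof. by move=> x0; rewrite inner_normE exprn_gt0 // normr_gt0. Qed.

HB.instance Definition _ :=
  @isDotProduct.Build R[i] H (@inner R H) inner_gt0.

End InnerDot.

Section Operators.
Variables (R : realType) (H : hilbertType R).
Implicit Types (A T : H -> H) (x y z : H).

Definition rnorm (V : normedZmodType R[i]) (v : V) : R := complex.Re `|v|.

Definition bounded_op A : Prop := bounded_near A (nbhs (0 : H)).

Definition opnorm T : R := sup [set rnorm (T x) | x in [set x | `|x| <= 1]].

(* For a bounded linear [A] the defining set is a singleton (Riesz). *)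
Definition adjoint A y : H :=
  xget 0 [set z | forall x, inner (A x) y = inner x z].

Lemma adjoint_unique A y z :
  (forall x, inner (A x) y = inner x z) -> adjoint A y = z.
Proof.
move=> Az; apply: xget_unique => //= t At.
have /eqP : inner (t - z) (t - z) = 0.
  by rewrite linearBr /= -At Az subrr.
by rewrite dnorm_eq0 subr_eq0 => /eqP.
Qed.

Definition numerical_range A : set R[i] :=
  [set inner (A x) x | x in [set x | `|x| = 1]].

Definition numerical_radius A : R :=
  sup [set rnorm (inner (A x) x) | x in [set x | `|x| = 1]].

End Operators.

(* Any part of the bounding circle may belong to [D].  The last clause matters
   because for [k = 0] the inclusions alone would allow the empty set. *)
Definition circular_disk0 (R : realType) (k : R) (D : set R[i]) : Prop :=
  [/\ [set z | `|z| < k%:C] `<=` D,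
      D `<=` [set z | `|z| <= k%:C] &
      k = 0 -> D = [set 0]].

(* Main.v *)
(* Write [A = T + iU] with [T], [U] self-adjoint, so that
   [A^*A + AA^* = 2 (T^2 + U^2)].  Either norm equality yields vectors [x] of
   norm at most 1 with [|Ax|^2 + |A^*x|^2] close to [4 w^2], hence with
   [|T'x|] close to [w] for every combination [T' = aT + bU], [a^2 + b^2 = 1];
   since [|T'| <= w], this forces [T'^2 x ~ w^2 x], and varying [a], [b] gives
   [(TU + UT) x ~ 0].  Now [y = (T + w) x] satisfies [Ty ~ wy]; and if this [y]
   is negligible, then [Tx ~ -wx], so [T (Ux) ~ - U (Tx) ~ w Ux] with [|Ux|]
   close to [w].  In both cases [w] lies in the approximate spectrum of [T], and
   rotating [A] shows that [W(A)] has support [w] in every direction.  Being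
   convex (Toeplitz-Hausdorff), it contains the open disk of radius [w]. *)
From HB Require Import structures.
Require Import Defs.
From mathcomp Require Import all_boot all_order all_algebra.
From mathcomp Require Import sesquilinear complex.
From mathcomp Require Import all_classical all_reals all_analysis.
From mathcomp Require Import ring lra.
Set Implicit Arguments.
Unset Strict Implicit.
Unset Printing Implicit Defensive.

Import Order.TTheory GRing.Theory Num.Theory.
Local Open Scope ring_scope.

Lemma complex_ReD (R : realType) :
  {morph (@complex.Re R : R[i] -> R) : x y / x + y}.
Proof. by move=> [a b] [c d]. Qed.

Lemma complex_Re_realM (R : realType) (a : R) (z : R[i]) :
  complex.Re (a%:C%C * z) = a * complex.Re z.
Proof. by case: z => c d /=; rewrite mul0r subr0. Qed.

(** * The real inner product underlying the complex one *)

Section RealInner.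
Variables (R : realType) (H : hilbertType R).
Implicit Types x y z : H.

Lemma innerDl x y z : inner (x + y) z = inner x z + inner y z.
Proof. exact: linearDl. Qed.

Lemma innerDr x y z : inner z (x + y) = inner z x + inner z y.
Proof. exact: linearDr. Qed.

Lemma innerZl a x y : inner (a *: x) y = a * inner x y.
Proof. exact: linearZl_LR. Qed.

Lemma innerZr a x y : inner x (a *: y) = a^*%R * inner x y.
Proof. exact: linearZr_LR. Qed.

Definition rinner x y : R := complex.Re (inner x y).
Definition sqnorm x : R := rinner x x.

Lemma rinnerC x y : rinner x y = rinner y x.
Proof. by rewrite /rinner innerC; case: (inner y x). Qed.

Lemma rinnerDl x y z : rinner (x + y) z = rinner x z + rinner y z.
Proof. by rewrite /rinner linearDl complex_ReD. Qed.

Lemma rinnerDr x y z : rinner z (x + y) = rinner z x + rinner z y.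
Proof. by rewrite !(rinnerC z) rinnerDl. Qed.

Lemma rinnerZl (a : R) x y : rinner (a%:C%C *: x) y = a * rinner x y.
Proof. by rewrite /rinner linearZl complex_Re_realM. Qed.

Lemma rinnerZr (a : R) x y : rinner x (a%:C%C *: y) = a * rinner x y.
Proof. by rewrite rinnerC rinnerZl rinnerC. Qed.

Lemma rinnerNl x y : rinner (- x) y = - rinner x y.
Proof.
have iN : inner (- x) y = - inner x y by exact: linearNl.
by rewrite /rinner iN; case: (inner x y).
Qed.

Lemma rinnerNr x y : rinner x (- y) = - rinner x y.
Proof. by rewrite rinnerC rinnerNl rinnerC. Qed.

Definition rinnerE :=
  (rinnerDl, rinnerDr, rinnerNl, rinnerNr, rinnerZl, rinnerZr).

(** By conjugate-linearity, the factor i in the second argument brings the imaginary part into real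
    position, so real inner products recover the complex one. *)
Lemma inner_eq_rinner x y :
  inner x y = (rinner x y +i* rinner x ('i%C *: y))%C.
Proof.
rewrite /rinner [in X in (_ +i* X)%C]innerC linearZl /= [inner y x]innerC.
by case: (inner x y) => a b; rewrite /= mul0r mul1r sub0r opprK.
Qed.

Lemma normE x : `|x| = (rnorm x)%:C%C.
Proof. by rewrite /rnorm RRe_real ?normr_real. Qed.

Lemma rnorm_ge0 (V : normedZmodType R[i]) (v : V) : 0 <= rnorm v.
Proof. by rewrite /rnorm; have := normr_ge0 v; rewrite lecE => /andP[]. Qed.

Lemma inner_sqnorm x : inner x x = (sqnorm x)%:C%C.
Proof.
rewrite /sqnorm /rinner RRe_real // inner_normE.
by rewrite rpredX // normr_real.
Qed.

Lemma sqnormE x : sqnorm x = rnorm x ^+ 2.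
Proof.
have := inner_sqnorm x; rewrite inner_normE normE -rmorphXn /=.
by move=> /(congr1 (@complex.Re R)).
Qed.

Lemma sqnorm_ge0 x : 0 <= sqnorm x.
Proof. by rewrite sqnormE sqr_ge0. Qed.

Lemma sqnorm_eq0 x : (sqnorm x == 0) = (x == 0).
Proof.
by rewrite sqnormE sqrf_eq0 -(inj_eq (@complexI R)) -normE normr_eq0.
Qed.

Lemma norm_eq1 x : (`|x| = 1) <-> (sqnorm x = 1).
Proof.
split=> [x1|]; first by rewrite sqnormE /rnorm x1 /= expr1n.
by move=> /eqP; rewrite sqnormE sqrp_eq1 ?rnorm_ge0// normE => /eqP ->.
Qed.

Lemma norm_le1 x : (`|x| <= 1) = (sqnorm x <= 1).
Proof.
rewrite sqnormE -[X in _ = (_ <= X)](expr1n _ 2) ler_pXn2r ?nnegrE ?rnorm_ge0//.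
by rewrite normE lecR.
Qed.

Lemma sqnormZ (a : R) x : sqnorm (a%:C%C *: x) = a ^+ 2 * sqnorm x.
Proof. by rewrite /sqnorm !rinnerE mulrA. Qed.

Lemma sqnormN x : sqnorm (- x) = sqnorm x.
Proof. by rewrite /sqnorm !rinnerE opprK. Qed.

Lemma sqnormD_le x y : sqnorm (x + y) <= 2 * sqnorm x + 2 * sqnorm y.
Proof.
have := sqnorm_ge0 (x - y); rewrite /sqnorm !rinnerE (rinnerC y x); lra.
Qed.

(** Expand |s x - y|^2 >= 0 and divide by s. This weighted form stands in for Cauchy-Schwarz. *)
Lemma rinner_le (s : R) x y : 0 < s ->
  2 * rinner x y <= s * sqnorm x + s^-1 * sqnorm y.
Proof.
move=> s0; have := sqnorm_ge0 (s%:C%C *: x - y).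
rewrite /sqnorm !rinnerE (rinnerC y x) -(ler_pM2l (_ : 0 < s^-1)) ?invr_gt0//.
rewrite mulr0 => h; rewrite -subr_ge0; apply: le_trans h _.
rewrite le_eqVlt; apply/orP; left.
by apply/eqP; field; rewrite gt_eqF.
Qed.

Lemma sqr_rnormE (z : R[i]) :
  rnorm z ^+ 2 = complex.Re z ^+ 2 + complex.Im z ^+ 2.
Proof. by rewrite /rnorm normc_def /= sqr_sqrtr// addr_ge0// sqr_ge0. Qed.

Lemma rinner_inj x y : (forall z, rinner x z = rinner y z) -> x = y.
Proof.
move=> xy; apply/eqP; rewrite -subr_eq0 -sqnorm_eq0.
by rewrite /sqnorm rinnerDl rinnerNl xy subrr.
Qed.

End RealInner.

(** * Estimates for pairs of self-adjoint operators *)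

Section SelfAdjoint.
Variables (R : realType) (H : hilbertType R).
Implicit Types (x y : H) (T U : {linear H -> H}).

Definition rselfadj (T : H -> H) := forall x y, rinner (T x) y = rinner x (T y).

(** Polarisation: with y = Tx / w, the forms at x + y and x - y differ by 4 |Tx|^2 / w, and the
    parallelogram law bounds this difference by 2 w (|x|^2 + |y|^2). *)
Lemma rselfadj_sqnorm_le T (w : R) : 0 < w -> rselfadj T ->
  (forall x, `|rinner (T x) x| <= w * sqnorm x) ->
  forall x, sqnorm (T x) <= w ^+ 2 * sqnorm x.
Proof.
move=> w0 sT Tw x.
have [y yE] : exists y, y = (w^-1)%:C%C *: T x by eexists.
have := Tw (x + y); rewrite ler_norml => /andP[_ p1].
have := Tw (x - y); rewrite ler_norml => /andP[p2 _].
have Ty : rinner (T y) x = w^-1 * sqnorm (T x).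
  by rewrite sT yE rinnerZl.
have Tx : rinner (T x) y = w^-1 * sqnorm (T x) by rewrite yE rinnerZr.
have yy : rinner y y = w^-2 * sqnorm (T x).
  by rewrite -/(sqnorm y) yE sqnormZ exprVn.
have {}yy : w * rinner y y = w^-1 * sqnorm (T x).
  by rewrite yy; field; rewrite gt_eqF.
move: p1 p2; rewrite linearD linearB /sqnorm !rinnerE (rinnerC y x) Ty Tx.
rewrite -!/(sqnorm _) => p1 p2.
have : 4 * (w^-1 * sqnorm (T x)) <= 2 * (w * sqnorm x + w * rinner y y).
  by rewrite /sqnorm in p1 p2 *; lra.
rewrite yy -(ler_pM2l w0) => h.
have e : w * (4 * (w^-1 * sqnorm (T x))) = 4 * sqnorm (T x).
  by field; rewrite gt_eqF.
have e' : w * (2 * (w * sqnorm x + w^-1 * sqnorm (T x))) =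
  2 * (w ^+ 2 * sqnorm x) + 2 * sqnorm (T x).
  by field; rewrite gt_eqF.
by rewrite e e' in h; lra.
Qed.

(** The square expands to |T^2 x|^2 - 2 w^2 |Tx|^2 + w^4 |x|^2, which is at most w^2 (w^2 -
    |Tx|^2). *)
Lemma rselfadj_almost_eigen T (w e : R) x : rselfadj T ->
  (forall x, sqnorm (T x) <= w ^+ 2 * sqnorm x) ->
  sqnorm x <= 1 -> w ^+ 2 - e <= sqnorm (T x) ->
  sqnorm (T (T x) - (w ^+ 2)%:C%C *: x) <= w ^+ 2 * e.
Proof.
move=> sT Tw x1 xe.
rewrite /sqnorm !rinnerE (rinnerC x) (sT (T x) x) -!/(sqnorm _).
have h1 := Tw (T x).
have h2 : 0 <= w ^+ 2 * (w ^+ 2 * (1 - sqnorm x)).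
  by apply: mulr_ge0 (sqr_ge0 _) (mulr_ge0 (sqr_ge0 _) _); rewrite subr_ge0.
have h3 : 0 <= w ^+ 2 * (sqnorm (T x) - w ^+ 2 + e).
  by apply: mulr_ge0 (sqr_ge0 _) _; lra.
lra.
Qed.

(** The hypothesis reads d |y|^2 <= <y, (w - T) y>; [rinner_le] with weight d then bounds w - T
    below. *)
Lemma rselfadj_below T (w d : R) : 0 < d ->
  (forall y, rinner (T y) y <= (w - d) * sqnorm y) ->
  forall y, d ^+ 2 * sqnorm y <= sqnorm (w%:C%C *: y - T y).
Proof.
move=> d0 Td y; have := Td y.
have := @rinner_le _ _ d y (w%:C%C *: y - T y) d0.
set q := sqnorm (_ - _).
rewrite !rinnerE (rinnerC y (T y)) -!/(sqnorm _) => h1 h2.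
have : d * sqnorm y <= d^-1 * q by lra.
by rewrite -(ler_pM2l d0) mulrA mulrA divff ?gt_eqF// mul1r expr2.
Qed.

Lemma sqnormD3_le x y z :
  sqnorm (x + y + z) <= 3 * (sqnorm x + sqnorm y + sqnorm z).
Proof.
have := sqnorm_ge0 (x - y); have := sqnorm_ge0 (x - z).
have := sqnorm_ge0 (y - z).
by rewrite /sqnorm !rinnerE (rinnerC z x) (rinnerC y x) (rinnerC z y); lra.
Qed.

(** By contradiction: if the form of [T] stays below w - d, then w - T is bounded below, which makes
    first (T + w) x and then Ux small, whereas |Ux|^2 is close to w^2. *)
Lemma sup_rselfadj_pair T U (w : R) : 0 < w -> rselfadj T -> rselfadj U ->
  (forall a b x, a ^+ 2 + b ^+ 2 = 1 ->
     `|a * rinner (T x) x + b * rinner (U x) x| <= w * sqnorm x) ->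
  (forall e : R, 0 < e -> exists2 x, sqnorm x <= 1 &
     2 * w ^+ 2 - e <= sqnorm (T x) + sqnorm (U x)) ->
  forall d, 0 < d -> exists y, (w - d) * sqnorm y < rinner (T y) y.
Proof.
move=> w0 sT sU TUw TUx d d0.
apply: contrapT => /forallNP Td.
have {}Td y : rinner (T y) y <= (w - d) * sqnorm y by rewrite leNgt; apply/negP.
(* A third direction besides [T] and [U] recovers the anticommutator:
   [12 (TU + UT) = 25 P^2 - 9 T^2 - 16 U^2]. *)
pose P : {linear H -> H} := ((3 / 5)%:C%C \*: T) \+ ((4 / 5)%:C%C \*: U).
have PE x : P x = (3 / 5)%:C%C *: T x + (4 / 5)%:C%C *: U x by [].
have sP : rselfadj P by move=> x y; rewrite !PE !rinnerE sT sU.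
have Tw : forall x, sqnorm (T x) <= w ^+ 2 * sqnorm x.
  apply: rselfadj_sqnorm_le => // x.
  by have := TUw 1 0 x; rewrite mul1r mul0r addr0; apply; ring.
have Uw : forall x, sqnorm (U x) <= w ^+ 2 * sqnorm x.
  apply: rselfadj_sqnorm_le => // x.
  by have := TUw 0 1 x; rewrite mul1r mul0r add0r; apply; ring.
have Pw : forall x, sqnorm (P x) <= w ^+ 2 * sqnorm x.
  apply: rselfadj_sqnorm_le => // x.
  by have := TUw (3 / 5) (4 / 5) x; rewrite PE !rinnerE; apply; field.
(* The direction orthogonal to [P]: the two squared norms sum to |Tx|^2 + |Ux|^2, so this upper
   bound keeps |Px|^2 close to w^2. *)
have Qw : forall x, sqnorm ((4 / 5)%:C%C *: T x - (3 / 5)%:C%C *: U x)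
    <= w ^+ 2 * sqnorm x.
  pose Q : {linear H -> H} := ((4 / 5)%:C%C \*: T) \- ((3 / 5)%:C%C \*: U).
  have QE x : Q x = (4 / 5)%:C%C *: T x - (3 / 5)%:C%C *: U x by [].
  have sQ : rselfadj Q by move=> x y; rewrite !QE !rinnerE sT sU.
  move=> x; rewrite -QE.
  apply: rselfadj_sqnorm_le x => // x.
  by have := TUw (4 / 5) (- (3 / 5)) x; rewrite QE !rinnerE mulNr; apply; field.
(* [M] gathers the constants of the bound |Ux|^2 <= M e derived below; [e] is chosen so that (1 + M)
   e = w^2 / 2, against w^2 - e <= |Ux|^2. *)
pose M := (2 * (w ^+ 2 * w ^+ 2 / d ^+ 2) + 42 * w ^+ 2) / d ^+ 2.
have w20 : 0 < w ^+ 2 by rewrite exprn_gt0.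
have M0 : 0 <= M.
  apply: divr_ge0 (sqr_ge0 _); apply: addr_ge0; last by lra.
  apply: mulr_ge0 => //; apply: divr_ge0 (sqr_ge0 _).
  exact: mulr_ge0 (sqr_ge0 _) (sqr_ge0 _).
pose e := w ^+ 2 / (2 * (1 + M)).
have e0 : 0 < e by rewrite divr_gt0// mulr_gt0//; lra.
have [x x1 xe] := TUx e e0.
have w2x : w ^+ 2 * sqnorm x <= w ^+ 2 by rewrite ler_piMr// ltW.
have hT : w ^+ 2 - e <= sqnorm (T x) by have := Uw x; lra.
have hU : w ^+ 2 - e <= sqnorm (U x) by have := Tw x; lra.
have hP : w ^+ 2 - e <= sqnorm (P x).
  have := Qw x.
  have : sqnorm (P x) + sqnorm ((4 / 5)%:C%C *: T x - (3 / 5)%:C%C *: U x)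
     = sqnorm (T x) + sqnorm (U x).
    by rewrite PE /sqnorm !rinnerE; field.
  lra.
have eT := rselfadj_almost_eigen sT Tw x1 hT.
have eU := rselfadj_almost_eigen sU Uw x1 hU.
have eP := rselfadj_almost_eigen sP Pw x1 hP.
set E := w ^+ 2 * e in eT eU eP.
have E0 : 0 < E by exact: mulr_gt0.
(* 21 rounds up 3 (25^2 + 9^2 + 16^2) / 12^2. *)
have anti : sqnorm (T (U x) + U (T x)) <= 21 * E.
  have -> : T (U x) + U (T x) =
    (25 / 12)%:C%C *: (P (P x) - (w ^+ 2)%:C%C *: x)
    - (9 / 12)%:C%C *: (T (T x) - (w ^+ 2)%:C%C *: x)
    - (16 / 12)%:C%C *: (U (U x) - (w ^+ 2)%:C%C *: x).
    by apply: rinner_inj => z; rewrite !PE !linearD !linearZ /= !rinnerE; field.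
  apply: le_trans (sqnormD3_le _ _ _) _; rewrite !sqnormN !sqnormZ; lra.
have b1 := rselfadj_below d0 Td (T x + w%:C%C *: x).
have b2 := rselfadj_below d0 Td (U x).
(* Here (w - T) (T + w) x = w^2 x - T^2 x. *)
have f1 : sqnorm (w%:C%C *: (T x + w%:C%C *: x) - T (T x + w%:C%C *: x)) <= E.
  rewrite -sqnormN; set v := - _.
  suff -> : v = T (T x) - (w ^+ 2)%:C%C *: x by [].
  apply: rinner_inj => z.
  by rewrite /v (linearD T) [T (_ *: _)]linearZ /= !rinnerE; ring.
(* Here (w - T) Ux = U (T + w) x - (TU + UT) x. *)
have f2 : sqnorm (w%:C%C *: U x - T (U x)) <=
    2 * (w ^+ 2 * sqnorm (T x + w%:C%C *: x)) + 42 * E.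
  have -> : w%:C%C *: U x - T (U x) =
      U (T x + w%:C%C *: x) - (T (U x) + U (T x)).
    apply: rinner_inj => z.
    by rewrite (linearD U) [U (_ *: _)]linearZ /= !rinnerE; ring.
  apply: le_trans (sqnormD_le _ _) _; rewrite sqnormN.
  have := Uw (T x + w%:C%C *: x); lra.
have d20 : 0 < d ^+ 2 by rewrite exprn_gt0.
have g1 : sqnorm (T x + w%:C%C *: x) <= E / d ^+ 2.
  by rewrite ler_pdivlMr// mulrC; lra.
have g2 : sqnorm (U x) <= M * e.
  have -> : M * e = (2 * (w ^+ 2 * (E / d ^+ 2)) + 42 * E) / d ^+ 2.
    by rewrite /M /E; field; rewrite gt_eqF.
  rewrite ler_pdivlMr// mulrC; apply: le_trans b2 (le_trans f2 _).
  by rewrite lerD2r ler_pM2l// ler_pM2l.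
have : w ^+ 2 <= (1 + M) * e by lra.
have -> : (1 + M) * e = w ^+ 2 / 2 by rewrite /e; field; lra.
lra.
Qed.
End SelfAdjoint.

(** * Convexity of the numerical range *)

Section NumericalRange.
Variables (R : realType) (H : hilbertType R).
Implicit Types (x y : H) (A : {linear H -> H}) (p q : R[i]).

Lemma mem_numerical_range A x p : x != 0 -> inner (A x) x = p * inner x x ->
  numerical_range A p.
Proof.
move=> x0 Ax; have nx0 : `|x| != 0 by rewrite normr_eq0.
exists (`|x|^-1 *: x).
  by rewrite /= normrZ normrV ?unitfE// normr_id mulVf.
have nC : (`|x|^-1)^*%R = `|x|^-1 by rewrite conj_Creal// rpredV normr_real.
rewrite linearZ /= innerZl innerZr Ax inner_normE.
by rewrite nC; field.
Qed.

Lemma quadratic_root (l c : R) : 0 < l -> l < 1 ->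
  exists t : R, (1 - l) * t ^+ 2 + c * t - l = 0.
Proof.
move=> l0 l1; pose D := c ^+ 2 + 4 * l * (1 - l).
have D0 : 0 <= D.
  by rewrite /D addr_ge0 ?sqr_ge0// mulr_ge0 ?subr_ge0 1?ltW// mulr_gt0.
exists ((Num.sqrt D - c) / (2 * (1 - l))).
have e : Num.sqrt D ^+ 2 = c ^+ 2 + 4 * l * (1 - l) by rewrite sqr_sqrtr.
have -> : (1 - l) * ((Num.sqrt D - c) / (2 * (1 - l))) ^+ 2 +
    c * ((Num.sqrt D - c) / (2 * (1 - l))) - l =
    (Num.sqrt D ^+ 2 - c ^+ 2 - 4 * l * (1 - l)) / (4 * (1 - l)).
  by field; rewrite subr_eq0 gt_eqF.
by rewrite e; field; rewrite subr_eq0 gt_eqF.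
Qed.

(* Multiplying the second vector by a suitable phase makes the cross terms of
   the quadratic form real. *)
Lemma real_phase p q : exists2 u : R[i], `|u| = 1 &
  u^*%R * p + u * q \is Num.real.
Proof.
pose d := q - p^*%R.
have [d0|d0] := eqVneq d 0.
  exists 1; first exact: normr1.
  have -> : q = p^*%R by apply/eqP; rewrite -subr_eq0 -/d d0.
  rewrite conjC1 !mul1r; apply/CrealP.
  by rewrite rmorphD /= conjCK addrC.
(* With q = p^* + d the sum is u^* p + u p^* + u d; the first two terms add up to a real number, and
   this [u] makes u d = |d|. *)
exists (d^*%R / `|d|).
  by rewrite normf_div norm_conjC normr_id divff// normr_eq0.
have nC : (`|d|^-1)^*%R = `|d|^-1 by rewrite conj_Creal// rpredV normr_real.
apply/CrealP; rewrite rmorphD !rmorphM /= !conjCK !nC.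
have -> : q^*%R = d^*%R + p by rewrite /d rmorphB /= conjCK subrK.
have -> : q = d + p^*%R by rewrite /d subrK.
by ring.
Qed.

(* Toeplitz-Hausdorff *)
Lemma numerical_range_convex A p q (l : R) : 0 <= l -> l <= 1 ->
  numerical_range A p -> numerical_range A q ->
  numerical_range A (p + l%:C%C * (q - p)).
Proof.
move=> l0 l1 Wp Wq.
have [->|ln0] := eqVneq l 0; first by rewrite mul0r addr0.
have [->|ln1] := eqVneq l 1; first by rewrite mul1r addrC subrK.
have [<-|npq] := eqVneq p q; first by rewrite subrr mulr0 addr0.
have {}l0 : 0 < l by rewrite lt_neqAle eq_sym ln0.
have {}l1 : l < 1 by rewrite lt_neqAle ln1.
case: Wp Wq => x /= x1 Ax [y /= y1 Ay].
have xx : inner x x = 1 by rewrite inner_normE x1 expr1n.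
have yy : inner y y = 1 by rewrite inner_normE y1 expr1n.
have qp : q - p != 0 by rewrite subr_eq0 eq_sym.
(* Cross terms of (A - p) / (q - p), whose form takes the values 0 at [x] and 1 at [y]. *)
pose X := (inner (A x) y - p * inner x y) / (q - p).
pose Y := (inner (A y) x - p * inner y x) / (q - p).
have [u u1 ur] := real_phase X Y.
pose c := complex.Re (u^*%R * X + u * Y).
have cE : u^*%R * X + u * Y = c%:C%C by rewrite /c RRe_real.
pose d := complex.Re (u^*%R * inner x y + u * inner y x).
have dE : u^*%R * inner x y + u * inner y x = d%:C%C.
  rewrite /d RRe_real//; apply/CrealP.
  by rewrite rmorphD !rmorphM /= conjCK -!innerC addrC.
have uu : u * u^*%R = 1 by rewrite -normCK u1 expr1n.
(* The equation says (t^2 + c t) / (1 + t^2 + d t) = l, where the left side is the Rayleigh quotient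
   of (A - p) / (q - p) at [z]. *)
have [t tE] := quadratic_root (c - l * d) l0 l1.
pose z := x + (t%:C%C * u) *: y.
have tC : (t%:C%C : R[i])^*%R = t%:C%C by rewrite conj_Creal// complex_real.
have zz : inner z z = (1 + t ^+ 2 + t * d)%:C%C.
  rewrite /z !(innerDl, innerDr, innerZl, innerZr) xx yy rmorphM /= tC.
  rewrite !rmorphD !rmorphM /= -dE ?rmorphXn /=.
  transitivity (1 + t%:C%C ^+ 2 * (u * u^*%R) +
    t%:C%C * (u^*%R * inner x y + u * inner y x)).
    by ring.
  by rewrite uu; ring.
have Azz : inner (A z) z = p * inner z z + (q - p) * (t ^+ 2 + t * c)%:C%C.
  have qX : inner (A x) y = (q - p) * X + p * inner x y by rewrite /X; field.
  have qY : inner (A y) x = (q - p) * Y + p * inner y x by rewrite /Y; field.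
  rewrite zz /z linearD linearZ /= !(innerDl, innerDr, innerZl, innerZr).
  rewrite Ax Ay qX qY rmorphM /= tC.
  rewrite !rmorphD !rmorphM /= -dE -cE ?rmorphXn /=.
  transitivity (p + q * t%:C%C ^+ 2 * (u * u^*%R) +
     t%:C%C * (q - p) * (u^*%R * X + u * Y) +
     p * t%:C%C * (u^*%R * inner x y + u * inner y x)).
    by ring.
  by rewrite uu; ring.
(* If [z] vanished, [x] would be a unimodular multiple of [y], forcing p = q. *)
have z0 : z != 0.
  apply: contra_neq npq => /eqP; rewrite addr_eq0 -scaleNr.
  set r := - _ => /eqP xE.
  have rr : inner x x = r * r^*%R by rewrite xE innerZl innerZr yy mulr1.
  rewrite xx in rr.
  by rewrite -Ax -Ay xE linearZ /= innerZl innerZr mulrA -rr mul1r.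
apply: (mem_numerical_range z0).
have tlE : t ^+ 2 + t * c = l * (1 + t ^+ 2 + t * d) by lra.
by rewrite Azz zz tlE rmorphM /=; ring.
Qed.

End NumericalRange.

(** * Convex planar sets with constant support function *)

Section ConvexDisk.
Variable R : realType.
Implicit Types (S : set R[i]) (w r e : R) (p q c z : R[i]).

Definition cconvex S := forall p q (l : R), 0 <= l -> l <= 1 ->
  S p -> S q -> S (p + l%:C%C * (q - p)).

Definition cross (a b a' b' : R) := a * b' - b * a'.

(** The positive cross products place 0 to the left of each side of the triangle. It is reached by
    combining the last two vertices, then the result with the first. *)
Lemma cconvex_triangle S (a1 b1 a2 b2 a3 b3 : R) : cconvex S ->
  S (a1 +i* b1)%C -> S (a2 +i* b2)%C -> S (a3 +i* b3)%C ->
  0 < cross a1 b1 a2 b2 -> 0 < cross a2 b2 a3 b3 -> 0 < cross a3 b3 a1 b1 ->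
  S 0.
Proof.
move=> cS S1 S2 S3 k3 k1 k2.
set d1 := cross a2 _ _ _ in k1; set d2 := cross a3 _ _ _ in k2.
set d3 := cross a1 _ _ _ in k3.
have frac01 (x y : R) : 0 < x -> 0 < y -> 0 <= y / (x + y) <= 1.
  move=> x0 y0; have xy0 := addr_gt0 x0 y0.
  apply/andP; split; first by rewrite divr_ge0 ?ltW.
  by rewrite ler_pdivrMr// mul1r lerDr ltW.
(* The barycentric coordinates of [0] are proportional to [d1], [d2], [d3]. *)
have m01 := frac01 _ _ k2 k3.
have l01 := frac01 _ _ k1 (addr_gt0 k2 k3).
case/andP: m01 => m0 m1; case/andP: l01 => l0 l1.
have := cS _ _ _ l0 l1 S1 (cS _ _ _ m0 m1 S2 S3).
congr S.
have d23 : d2 + d3 != 0 by rewrite gt_eqF// addr_gt0.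
have d123 : d1 + (d2 + d3) != 0.
  by rewrite gt_eqF//; exact: addr_gt0 k1 (addr_gt0 k2 k3).
apply/eqP; rewrite eq_complex /= !mul0r.
move: d23 d123; rewrite /d1 /d2 /d3 /cross => d23 d123.
by apply/andP; split; apply/eqP; field; exact/andP.
Qed.

(* With [p = a + ib] and [c = c1 + i c2]: if [|p| <= w] and [Re (c p)] is nearly
   [w], then [p] is close to [w c^*]. *)
Lemma near_extremal w m (a b c1 c2 : R) : 0 < w -> 0 <= m ->
  c1 ^+ 2 + c2 ^+ 2 = 1 -> a ^+ 2 + b ^+ 2 <= w ^+ 2 ->
  w - m ^+ 2 / (2 * w) < c1 * a - c2 * b ->
  `|a - c1 * w| <= m /\ `|b + c2 * w| <= m.
Proof.
move=> w0 m0 c12 ab; rewrite -(ltr_pM2l (_ : 0 < 2 * w)) ?mulr_gt0// mulrBr.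
rewrite [X in _ - X]mulrC divfK ?gt_eqF ?mulr_gt0// => h.
(* The squared distance from p to w c^* is |p|^2 + w^2 - 2 w Re (c p); the tolerance m^2 / (2 w)
   makes it less than m^2. *)
have eq : (a - c1 * w) ^+ 2 + (b + c2 * w) ^+ 2 =
   a ^+ 2 + b ^+ 2 + (c1 ^+ 2 + c2 ^+ 2) * w ^+ 2 - 2 * w * (c1 * a - c2 * b).
  by ring.
rewrite c12 in eq.
have sa := sqr_ge0 (a - c1 * w); have sb := sqr_ge0 (b + c2 * w).
split; rewrite -(ler_pXn2r (_ : (0 < 2)%N)) ?nnegrE// real_normK ?num_real//.
  lra.
lra.
Qed.

(** A lower bound [w] on the support function in all directions, phrased without assuming that it is
    attained. *)
Definition supporting S w := forall c, `|c| = 1 -> forall e : R, 0 < e ->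
  exists2 p, S p & w - e < complex.Re (c * p).

(** [S] has points near w and w (-3 + 4i) / 5, w (-3 - 4i) / 5, the vertices of a triangle around r;
    translating by -r reduces to [cconvex_triangle]. *)
Lemma cconvex_disk_real S w r : cconvex S -> supporting S w ->
  (forall p, S p -> rnorm p <= w) -> 0 <= r -> r < w -> S r%:C%C.
Proof.
move=> cS dS Sw r0 rw.
have w0 : 0 < w by lra.
(* Errors of this size in the vertices keep the three cross products positive. *)
pose m := (w - r) / 100.
have m0 : 0 < m by rewrite divr_gt0// subr_gt0.
have near (c1 c2 : R) : c1 ^+ 2 + c2 ^+ 2 = 1 ->
    exists a b, [/\ S (a +i* b)%C, `|a - c1 * w| <= m & `|b + c2 * w| <= m].
  move=> c12.
  have c1E : `|(c1 +i* c2)%C| = 1 by rewrite normc_def /= c12 sqrtr1.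
  have [|[a b] Sab] := dS _ c1E (m ^+ 2 / (2 * w)).
    by apply: divr_gt0; [exact: exprn_gt0|exact: mulr_gt0].
  move=> /near_extremal [] //; first exact: ltW.
    rewrite -(sqr_rnormE (a +i* b)%C) ler_pXn2r ?nnegrE ?rnorm_ge0 ?(ltW w0)//.
    exact: Sw.
  by move=> h1 h2; exists a, b.
have [|a1 [b1 [S1 + +]]] := near 1 0; first by ring.
have [|a2 [b2 [S2 + +]]] := near (- (3 / 5)) (- (4 / 5)); first by field.
have [|a3 [b3 [S3 + +]]] := near (- (3 / 5)) (4 / 5); first by field.
rewrite !ler_norml => /andP[l3 u3] /andP[l3' u3'] /andP[l2 u2] /andP[l2' u2'].
move=> /andP[l1 u1] /andP[l1' u1'].
have cS' : cconvex (fun p => S (p + r%:C%C)).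
  move=> p q l l0 l01 Sp Sq /=; have := cS _ _ _ l0 l01 Sp Sq.
  by congr S; ring.
have S0 := @cconvex_triangle (fun p => S (p + r%:C%C))
  (a1 - r) b1 (a2 - r) b2 (a3 - r) b3 cS'.
have shift a b : ((a - r) +i* b)%C + r%:C%C = (a +i* b)%C.
  by apply/eqP; rewrite eq_complex /= subrK addr0 !eqxx.
have wm : w - r = 100 * m by rewrite /m; field.
rewrite -[r%:C%C]add0r; apply: S0; rewrite ?shift// /cross.
- nra.
- nra.
- nra.
Qed.

(** The hypotheses are invariant under rotation, so z may be turned onto the nonnegative real
    axis. *)
Lemma cconvex_disk S w z : cconvex S -> supporting S w ->
  (forall p, S p -> rnorm p <= w) -> `|z| < w%:C%C -> S z.
Proof.
move=> cS dS Sw zw.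
have zr : `|z| = (rnorm z)%:C%C by rewrite /rnorm RRe_real ?normr_real.
have rw : rnorm z < w by move: zw; rewrite zr ltcR.
have [u u1 zE] : exists2 u, `|u| = 1 & z = u * (rnorm z)%:C%C.
  have [z0|z0] := eqVneq z 0.
    by exists 1; rewrite ?normr1// mul1r -zr z0 normr0.
  exists (z / `|z|); first by rewrite normf_div normr_id divff// normr_eq0.
  by rewrite -zr divfK// normr_eq0.
have uu : u * u^*%R = 1 by rewrite -normCK u1 expr1n.
rewrite zE; apply: (@cconvex_disk_real (fun p => S (u * p)) w) => //; last 2 first.
- by move=> p /Sw; rewrite /rnorm normrM u1 mul1r.
- exact: rnorm_ge0.
- move=> p q l l0 l1 Sp Sq /=; have := cS _ _ _ l0 l1 Sp Sq.
  by congr S; ring.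
- move=> c c1 e e0.
  have [|p Sp pe] := dS (c * u^*%R) _ e e0.
    by rewrite normrM norm_conjC c1 u1 mulr1.
  by exists (u^*%R * p); rewrite mulrA ?uu ?mul1r.
Qed.

End ConvexDisk.

(** * Support of the numerical range in every direction *)

Section Supporting.
Variables (R : realType) (H : hilbertType R).
Implicit Types (x y : H) (A B : {linear H -> H}).

(** With T = (A + B) / 2 and U = (A - B) / (2i), the parallelogram law gives |Tx|^2 + |Ux|^2 =
    (|Ax|^2 + |Bx|^2) / 2, so [sup_rselfadj_pair] applies. *)
Lemma Re_numerical_range_approx A B (w : R) : 0 < w ->
  (forall x y, inner (A x) y = inner x (B y)) ->
  (forall x, rnorm (inner (A x) x) <= w * sqnorm x) ->
  (forall e : R, 0 < e -> exists2 x, sqnorm x <= 1 &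
     4 * w ^+ 2 - e <= sqnorm (A x) + sqnorm (B x)) ->
  forall e : R, 0 < e -> exists2 p, numerical_range A p & w - e < complex.Re p.
Proof.
move=> w0 AB Aw Ax e e0.
pose T : {linear H -> H} := (2^-1)%:C%C \*: (A \+ B).
pose U : {linear H -> H} := (- ('i * (2^-1)%:C))%C \*: (A \- B).
have TE x : T x = (2^-1)%:C%C *: (A x + B x) by [].
have UE x : U x = (- ('i * (2^-1)%:C))%C *: (A x - B x) by [].
have BA x y : inner (B x) y = inner x (A y) by rewrite innerC -AB -innerC.
have innerBl x y z : inner (x - y : H) z = inner x z - inner y z.
  by rewrite innerDl -scaleN1r innerZl mulN1r.
have innerBr x y z : inner z (x - y : H) = inner z x - inner z y.
  by rewrite [LHS]innerC innerBl rmorphB /= -!innerC.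
have sT : rselfadj T.
  by move=> x y; rewrite !TE !rinnerE /rinner AB BA addrC.
have sU : rselfadj U.
  move=> x y; rewrite !UE /rinner; congr complex.Re.
  rewrite innerZl innerZr innerBl innerBr AB BA -opprB mulrN -mulNr.
  congr (_ * _); apply/eqP; rewrite eq_complex /=.
  by apply/andP; split; apply/eqP; ring.
have Tx x : rinner (T x) x = complex.Re (inner (A x) x).
  by rewrite TE !rinnerE [rinner (B x) x]rinnerC /rinner -AB; field.
have Ux x : rinner (U x) x = complex.Im (inner (A x) x).
  rewrite UE /rinner innerZl innerBl BA [inner x (A x)]innerC.
  by case: (inner (A x) x) => a b /=; field.
have TUw a b x : a ^+ 2 + b ^+ 2 = 1 ->
     `|a * rinner (T x) x + b * rinner (U x) x| <= w * sqnorm x.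
  move=> ab; apply: le_trans (Aw x); rewrite Tx Ux.
  rewrite -(ler_pXn2r (_ : (0 < 2)%N)) ?nnegrE ?rnorm_ge0//.
  rewrite real_normK ?num_real// sqr_rnormE.
  set X := complex.Re _; set Y := complex.Im _.
  (* Lagrange's identity: this square is the defect in the planar Cauchy-Schwarz inequality. *)
  have := sqr_ge0 (a * Y - b * X).
  have -> : X ^+ 2 + Y ^+ 2 = (a ^+ 2 + b ^+ 2) * (X ^+ 2 + Y ^+ 2).
    by rewrite ab mul1r.
  lra.
have sqnormi x : sqnorm ((- ('i * (2^-1)%:C))%C *: x) = 4^-1 * sqnorm x.
  rewrite /sqnorm /rinner innerZl innerZr.
  by case: (inner x x) => a b /=; field.
have TUx d : 0 < d -> exists2 x, sqnorm x <= 1 &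
     2 * w ^+ 2 - d <= sqnorm (T x) + sqnorm (U x).
  move=> d0; have [x x1 h] := Ax d d0; exists x => //.
  rewrite UE sqnormi TE sqnormZ /sqnorm !rinnerE -!/(sqnorm _).
  by rewrite (rinnerC (B x)); lra.
have [y ye] := sup_rselfadj_pair w0 sT sU TUw TUx e0.
have y0 : y != 0.
  apply: contraTneq ye => ->; rewrite -leNgt.
  rewrite linear0 /sqnorm (_ : rinner 0 0 = 0) ?mulr0//; apply/eqP.
  by rewrite sqnorm_eq0.
have q0 : 0 < sqnorm y by rewrite lt_neqAle sqnorm_ge0 eq_sym sqnorm_eq0 y0.
exists ((sqnorm y)^-1%:C%C * inner (A y) y).
  apply: (mem_numerical_range y0).
  rewrite inner_sqnorm mulrAC -rmorphM /= mulVf ?mul1r//.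
  by rewrite gt_eqF.
rewrite complex_Re_realM -Tx -(ltr_pM2l q0) mulrA divff ?gt_eqF// mul1r.
by rewrite mulrC.
Qed.

(** Replacing A by c A and B by c^* B preserves every hypothesis and turns the direction [c] into
    the real one. *)
Lemma supporting_numerical_range A B (w : R) : 0 < w ->
  (forall x y, inner (A x) y = inner x (B y)) ->
  (forall x, rnorm (inner (A x) x) <= w * sqnorm x) ->
  (forall e : R, 0 < e -> exists2 x, sqnorm x <= 1 &
     4 * w ^+ 2 - e <= sqnorm (A x) + sqnorm (B x)) ->
  supporting (numerical_range A) w.
Proof.
move=> w0 AB Aw Ax c c1 e e0.
have cc : c * c^*%R = 1 by rewrite -normCK c1 expr1n.
pose A' : {linear H -> H} := c \*: A.
pose B' : {linear H -> H} := c^*%R \*: B.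
have sqnormc (d : R[i]) x : d * d^*%R = 1 -> sqnorm (d *: x) = sqnorm x.
  by move=> dd; rewrite /sqnorm /rinner innerZl innerZr mulrA dd mul1r.
have [] := @Re_numerical_range_approx A' B' w w0 _ _ _ e e0.
- by move=> x y; rewrite /A' /B' /= innerZl innerZr conjCK AB.
- by move=> x; rewrite /A' /= innerZl /rnorm normrM c1 mul1r; exact: Aw.
- move=> d d0; have [x x1 h] := Ax d d0; exists x => //.
  by rewrite /A' /B' /= !sqnormc// conjCK mulrC.
- move=> p [x x1 <-] pe; exists (inner (A x) x); first by exists x.
  by move: pe; rewrite /A' /= innerZl.
Qed.

End Supporting.

(** * Riesz representation and existence of the adjoint *)

Section Riesz.
Variables (R : realType) (H : hilbertType R).
Implicit Types (x y z : H).

Lemma lt_norm_sqnorm (e : R) x : 0 < e -> (`|x| < e%:C%C) = (sqnorm x < e ^+ 2).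
Proof.
move=> e0; rewrite sqnormE ltr_pXn2r ?nnegrE ?rnorm_ge0 ?(ltW e0)//.
by rewrite normE ltcR.
Qed.

Lemma sqnorm_complete (u : nat -> H) :
  (forall e : R, 0 < e -> exists N, forall m n, (N <= m)%N -> (N <= n)%N ->
    sqnorm (u m - u n) < e) ->
  exists z, forall e : R, 0 < e -> exists N, forall n, (N <= n)%N ->
    sqnorm (z - u n) < e.
Proof.
move=> cu.
have gt0C (e : R[i]) : 0 < e -> exists2 r : R, 0 < r & e = r%:C%C.
  case: e => a b; rewrite ltcE /= => /andP[/eqP -> a0]; by exists a.
have : cvg (u @ \oo)%classic.
  apply: cauchy_cvg; apply: cauchy_exP => e /gt0C[r r0 ->].
  have [N uN] := cu (r ^+ 2) (exprn_gt0 _ r0).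
  exists (u N); exists N => // n /= Nn.
  rewrite -ball_normE /= lt_norm_sqnorm//; exact: uN.
move=> /cvg_ex[z uz]; exists z => e e0.
have r0 : 0 < Num.sqrt e by rewrite sqrtr_gt0.
have r0C : 0 < (Num.sqrt e)%:C%C :> R[i] by rewrite ltcR.
have [N _ uN] := (cvgrPdist_lt _ _).1 uz _ r0C.
exists N => n /uN /=; rewrite lt_norm_sqnorm// sqr_sqrtr// ltW//.
Qed.

(* The representing vector minimizes [sqnorm x / 2 - f x]; a minimizing
   sequence is Cauchy by the parallelogram law. *)
Lemma riesz_real (f : H -> R) (M : R) :
  (forall x y, f (x + y) = f x + f y) ->
  (forall (a : R) x, f (a%:C%C *: x) = a * f x) ->
  (forall x, f x <= M + sqnorm x / 2) ->
  exists z, forall x, f x = rinner x z.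
Proof.
move=> fD fZ fM.
pose J x := sqnorm x / 2 - f x.
pose m := inf (range J).
have hm x : m <= J x.
  apply: ge_inf; last by exists x.
  by exists (- M) => _ [y _ <-]; rewrite /J; have := fM y; lra.
have hJ (e : R) : 0 < e -> exists x, J x < m + e.
  move=> e0; apply: contrapT => /forallNP hn.
  have : m + e <= m; last by lra.
  apply: lb_le_inf; first by exists (J 0); exists 0.
  by move=> _ [y _ <-]; rewrite leNgt; apply/negP.
(* The parallelogram law gives |x - y|^2 / 4 = J x + J y - 2 J ((x + y) / 2), and the midpoint value
   is at least m. *)
have near x y (d e : R) : J x < m + d -> J y < m + e ->
    sqnorm (x - y) < 4 * (d + e).
  move=> xd ye; have := hm ((2^-1)%:C%C *: (x + y)).
  rewrite /J fZ fD sqnormZ; move: xd ye.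
  rewrite /J /sqnorm !rinnerE (rinnerC y x).
  lra.
have [s s0 small] : exists2 s : nat -> R, forall n, 0 < s n &
    forall e : R, 0 < e -> exists N, forall n, (N <= n)%N -> s n < e.
  exists (fun n => n.+1%:R^-1) => [n|e /ltr_add_invr[N Ne]].
    by rewrite invr_gt0.
  exists N => n Nn; rewrite add0r in Ne.
  by apply: le_lt_trans Ne; rewrite lef_pV2 ?posrE// ler_nat.
have [u uJ] := choice (fun n => hJ (s n) (s0 n)).
have [e e0|z zu] := @sqnorm_complete u.
  have [|N Ne] := small (e / 8); first by rewrite divr_gt0.
  exists N => j k /Ne je /Ne ke.
  by apply: lt_le_trans (near _ _ _ _ (uJ j) (uJ k)) _; lra.
exists z => h; apply/eqP; rewrite -subr_eq0.
set D := f h - _.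
(* First variation of [J] in direction [h], taken at an almost minimal [u n]; replacing [u n] by [z]
   costs at most (|z - u n|^2 + t^2 |h|^2) / 2. *)
have lim (t e : R) : 0 < e -> 0 <= t ^+ 2 * sqnorm h - t * D + 2 * e.
  move=> e0; have [N1 zN] := zu e e0; have [N2 eN] := small e e0.
  have := zN _ (leq_maxl N1 N2); have := eN _ (leq_maxr N1 N2).
  set n := maxn _ _ => ne zn.
  have := sqnorm_ge0 (z - u n + t%:C%C *: h); have := hm (u n + t%:C%C *: h).
  have := uJ n; rewrite /D /J fD fZ; move: zn; rewrite /sqnorm !rinnerE.
  rewrite (rinnerC (u n) z) (rinnerC h z) (rinnerC h (u n)); lra.
(* The added 1 keeps k positive. Taking t = D / (2 k) and e = D^2 / (16 k) makes the bound in [lim]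
   at most - D^2 / (8 k). *)
apply: contrapT => /negP D0; pose k := sqnorm h + 1.
have k0 : 0 < k by rewrite ltr_wpDl// sqnorm_ge0.
have D20 : 0 < D ^+ 2 by rewrite lt_neqAle sqr_ge0 eq_sym sqrf_eq0 D0.
have E0 : 0 < D ^+ 2 / k by rewrite divr_gt0.
have := lim (D / (2 * k)) (D ^+ 2 / k / 16) ltac:(by rewrite divr_gt0).
have -> : D / (2 * k) * D = D ^+ 2 / k / 2 by field; rewrite gt_eqF.
have -> : (D / (2 * k)) ^+ 2 * sqnorm h = D ^+ 2 / k / 4 * (sqnorm h / k).
  by field; rewrite gt_eqF.
have : sqnorm h / k <= 1 by rewrite ler_pdivrMr// mul1r /k; lra.
move: E0; set E := D ^+ 2 / k => E0.
rewrite -(ler_pM2l (_ : 0 < E / 4)) ?divr_gt0//.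
lra.
Qed.

(** Represent the real functional x -> Re <Ax, y>; imaginary parts follow on replacing x by i x, and
    uniqueness of the representing vector makes [B] linear. *)
Lemma exists_adjoint (A : {linear H -> H}) (C : R) :
  (forall x, sqnorm (A x) <= C * sqnorm x) ->
  exists B : {linear H -> H}, forall x y, inner (A x) y = inner x (B y).
Proof.
move=> AC.
have riesz y : exists z, forall x, inner (A x) y = inner x z.
  have [|||z fz] := @riesz_real (fun x => rinner (A x) y)
    ((`|C| + 1) * sqnorm y / 2).
  - by move=> x z; rewrite linearD rinnerDl.
  - by move=> a x; rewrite linearZ rinnerZl.
  (* The weight absorbs the bound on [A]; |C| + 1 is positive whatever the sign of [C]. *)
  - move=> x; have s0 : 0 < (`|C| + 1)^-1 by rewrite invr_gt0 ltr_wpDl.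
    have := rinner_le (A x) y s0; rewrite invrK.
    have : (`|C| + 1)^-1 * sqnorm (A x) <= sqnorm x.
      rewrite mulrC ler_pdivrMr ?ltr_wpDl// mulrC.
      apply: le_trans (AC x) _; rewrite ler_wpM2r ?sqnorm_ge0//.
      by have := ler_norm C; lra.
    lra.
  exists z => x; rewrite inner_eq_rinner [RHS]inner_eq_rinner -fz.
  congr (_ +i* _)%C.
  have key (v w : H) : rinner v ('i%C *: w) = - rinner ('i%C *: v) w.
    by rewrite /rinner innerZr innerZl; case: (inner v w) => a b /=; ring.
  by rewrite !key -linearZ fz.
have [B AB] := choice riesz.
have BL : linear B.
  move=> a x y; apply: rinner_inj => z; rewrite ![rinner _ z]rinnerC /rinner.
  by rewrite -AB !innerDr !innerZr !AB.
pose BM := GRing.isLinear.Build _ _ _ _ B BL.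
pose B' : {linear H -> H} := HB.pack B BM.
by exists B'.
Qed.

End Riesz.

(** * Numerical radius and circular disks *)

Section NumericalRadius.
Variables (R : realType) (H : hilbertType R).
Implicit Types (x : H) (A B : {linear H -> H}).

Lemma bounded_op_sqnorm A : bounded_op A ->
  exists C : R, forall x, sqnorm (A x) <= C * sqnorm x.
Proof.
move=> /linear_boundedP Ab.
have [r r0 Ar] := pinfty_ex_gt0 Ab.
exists (complex.Re r ^+ 2) => x.
have rE : r = (complex.Re r)%:C%C by rewrite RRe_real// gtr0_real.
have := Ar x; rewrite rE !normE -rmorphM lecR => /(lerXn2r 2) h.
have Re0 : 0 <= complex.Re r by rewrite -(@lecR R) -rE ltW.
by rewrite !sqnormE -exprMn; apply: h; rewrite nnegrE ?mulr_ge0 ?rnorm_ge0.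
Qed.

Lemma numerical_range_nonempty A : (exists x : H, x != 0) ->
  exists p, numerical_range A p.
Proof.
move=> [x x0].
exists ((inner (A x) x) / inner x x); apply: (mem_numerical_range x0).
by rewrite divfK// inner_normE expf_eq0 normr_eq0 (negbTE x0).
Qed.

Lemma numerical_radiusE A :
  numerical_radius A = sup [set rnorm p | p in numerical_range A].
Proof.
congr sup; apply/seteqP; split=> [_ [x x1 <-]|_ [_ [x x1 <-] <-]];
  last by exists x.
by exists (inner (A x) x) => //; exists x.
Qed.

Lemma numerical_radius_ub A p : bounded_op A ->
  numerical_range A p -> rnorm p <= numerical_radius A.
Proof.
move=> /bounded_op_sqnorm[C AC] Wp; rewrite numerical_radiusE.
apply: ub_le_sup; last by exists p.
(* Real and imaginary part of <Ax, x> are at most (C + 1) / 2 in modulus, being real inner products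
   of Ax with x and i x; then 2 r <= 1 + r^2 for the modulus r. *)
exists ((1 + (C + 1) ^+ 2 / 2) / 2) => _ [_ [x /norm_eq1 x1 <-] <-].
have Ax := AC x; rewrite x1 mulr1 in Ax.
have re (y : H) : sqnorm y = 1 -> rinner (A x) y ^+ 2 <= ((C + 1) / 2) ^+ 2.
  move=> y1; have h1 := rinner_le (A x) y ltr01.
  have h2 := rinner_le (A x) (- y) ltr01.
  rewrite sqnormN rinnerNr invr1 !mul1r y1 in h1 h2.
  have : 0 <= ((C + 1) / 2 - rinner (A x) y) * ((C + 1) / 2 + rinner (A x) y).
    by apply: mulr_ge0; lra.
  lra.
have i1 : sqnorm ('i%C *: x) = 1.
  transitivity (sqnorm x) => //; rewrite /sqnorm /rinner innerZl innerZr.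
  by case: (inner x x) => a b /=; ring.
have := re _ x1; have := re _ i1; have := sqr_ge0 (rnorm (inner (A x) x) - 1).
have := sqr_rnormE (inner (A x) x); rewrite inner_eq_rinner /=.
lra.
Qed.

Lemma inner_le_numerical_radius A x : bounded_op A ->
  rnorm (inner (A x) x) <= numerical_radius A * sqnorm x.
Proof.
move=> Ab; have [->|x0] := eqVneq x 0.
  have -> : inner (A 0) 0 = 0 by rewrite linear0 inner_normE normr0 expr0n.
  have -> : sqnorm (0 : H) = 0 by apply/eqP; rewrite sqnorm_eq0.
  by rewrite mulr0 /rnorm normr0.
have q0 : 0 < sqnorm x by rewrite lt_neqAle sqnorm_ge0 eq_sym sqnorm_eq0 x0.
rewrite -ler_pdivrMr// mulrC.
have := @numerical_radius_ub A ((sqnorm x)^-1%:C%C * inner (A x) x) Ab.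
have -> : rnorm ((sqnorm x)^-1%:C%C * inner (A x) x) =
    (sqnorm x)^-1 * rnorm (inner (A x) x).
  rewrite /rnorm normrM ger0_norm ?complex_Re_realM//.
  by rewrite (@lecR R 0) invr_ge0 ltW.
apply; apply: (mem_numerical_range x0).
by rewrite inner_sqnorm mulrAC -rmorphM /= mulVf ?gt_eqF// mul1r.
Qed.

(** The outer inclusion bounds the radius by [k], and the real points k - e of the open disk
    approach that bound. *)
Lemma circular_disk0_radius A (k : R) : (exists x : H, x != 0) ->
  circular_disk0 k (numerical_range A) -> numerical_radius A = k.
Proof.
move=> H_nontrivial [kW Wk _]; rewrite numerical_radiusE.
have rnormR (r : R) : 0 <= r -> rnorm r%:C%C = r.
  by move=> r0; rewrite /rnorm ger0_norm// (@lecR R 0).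
have ub : ubound [set rnorm p | p in numerical_range A] k.
  move=> _ [p /Wk /= + <-].
  by rewrite -(@lecR R) /rnorm RRe_real ?normr_real.
have ne : ([set rnorm p | p in numerical_range A] !=set0)%classic.
  have [p Wp] := numerical_range_nonempty A H_nontrivial.
  by exists (rnorm p), p.
apply/eqP; rewrite eq_le (ge_sup ne ub)/=.
apply/ler_addgt0Pr => e e0; rewrite -lerBlDr.
have [ke|ke] := leP (k - e) 0.
  apply: le_trans ke _; have [_ [p Wp _]] := ne.
  by apply: le_trans (rnorm_ge0 p) (ub_le_sup _ _); [exists k|exists p].
apply: ub_le_sup; first by exists k.
exists (k - e)%:C%C; last by rewrite rnormR// ltW.
by apply: kW => /=; rewrite ger0_norm ?ltcR ?lecR ?(ltW ke)// ltrBlDr ltrDl.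
Qed.

Lemma circular_disk0_numerical_range A B :
  (exists x : H, x != 0) -> bounded_op A ->
  (forall x y, inner (A x) y = inner x (B y)) ->
  (0 < numerical_radius A -> forall e : R, 0 < e -> exists2 x, sqnorm x <= 1 &
     4 * numerical_radius A ^+ 2 - e <= sqnorm (A x) + sqnorm (B x)) ->
  circular_disk0 (numerical_radius A) (numerical_range A).
Proof.
move=> H_nontrivial Ab AB; set w := numerical_radius A => Ax.
have Ww : (numerical_range A `<=` [set z | `|z| <= w%:C%C])%classic.
  move=> p /(numerical_radius_ub Ab) /=.
  by rewrite -lecR /rnorm RRe_real ?normr_real.
have w0 : 0 <= w.
  have [p Wp] := numerical_range_nonempty A H_nontrivial.
  exact: le_trans (rnorm_ge0 p) (numerical_radius_ub Ab Wp).
split => // [z /= zw|wE].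
  have {}w0 : 0 < w by rewrite -(@ltcR R); exact: le_lt_trans (normr_ge0 z) zw.
  apply: (cconvex_disk _ _ _ zw).
  - by move=> p q l l0 l1; exact: numerical_range_convex.
  - apply: (supporting_numerical_range w0 AB _ (Ax w0)) => x.
    exact: inner_le_numerical_radius.
  - by move=> p; exact: numerical_radius_ub.
(* For radius 0 the open disk is empty, so the last clause is proved from nonemptiness of the
   range. *)
have W0 p : numerical_range A p -> p = 0.
  by move=> /Ww /=; rewrite wE normr_le0 => /eqP.
apply/seteqP; split=> [p /W0 //|_ ->].
by have [p Wp] := numerical_range_nonempty A H_nontrivial; rewrite -(W0 p Wp).
Qed.

End NumericalRadius.

(** * Vectors almost attaining an operator norm *)

Section OperatorNorm.
Variables (R : realType) (H : hilbertType R).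
Implicit Types (x y : H) (T : H -> H).

Lemma opnorm_approx T (s : R) : s < opnorm T ->
  exists2 x, sqnorm x <= 1 & s < rnorm (T x).
Proof.
move=> sT; apply: contrapT => Tx.
move: sT; apply/negP; rewrite -leNgt; apply: ge_sup.
  by exists (rnorm (T 0)), 0 => //=; rewrite normr0 ler01.
move=> _ [x /= x1 <-]; rewrite leNgt; apply/negP => sx; apply: Tx.
by exists x; rewrite -?norm_le1.
Qed.

Lemma opnorm_ge0 T : 0 <= opnorm T.
Proof.
rewrite leNgt; apply/negP => T0.
(* [T] is an arbitrary map here; without a supremum, [sup] takes the default value 0. *)
have [h|h] := pselect (has_sup
    [set rnorm (T x) | x in [set x : H | `|x| <= 1]]).
  move: T0; apply/negP; rewrite -leNgt.
  apply: le_trans (rnorm_ge0 (T 0)) (ub_le_sup h.2 _).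
  by exists 0 => //=; rewrite normr0 ler01.
by move: T0; rewrite /opnorm sup_out// ltxx.
Qed.

(** For y = Sx / |Sx|, |Sx| = <Ax, Ay> + <Bx, By> is at most the mean of |Ax|^2 + |Bx|^2 and |Ay|^2
    + |By|^2, so [x] or [y] serves. *)
Lemma opnorm_gram_approx (A B : {linear H -> H}) (s : R) :
  (forall x y, inner (A x) y = inner x (B y)) ->
  s < opnorm (fun x => B (A x) + A (B x)) ->
  exists2 x, sqnorm x <= 1 & s <= sqnorm (A x) + sqnorm (B x).
Proof.
move=> AB /opnorm_approx[x x1]; set Sx := B (A x) + A (B x) => sx.
have BA u v : inner (B u) v = inner u (A v) by rewrite innerC -AB -innerC.
have [n0|n0] := leP (rnorm Sx) 0.
  exists x => //; apply: ltW; apply: lt_le_trans sx (le_trans n0 _).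
  by apply: addr_ge0; exact: sqnorm_ge0.
pose y := ((rnorm Sx)^-1)%:C%C *: Sx.
have y1 : sqnorm y = 1.
  by rewrite sqnormZ sqnormE -exprMn mulVf ?gt_eqF// expr1n.
have e1 : rinner Sx y = rnorm Sx.
  by rewrite rinnerZr -/(sqnorm Sx) sqnormE expr2 mulrA mulVf ?gt_eqF// mul1r.
have e2 : rinner Sx y = rinner (A x) (A y) + rinner (B x) (B y).
  by rewrite {1}/Sx rinnerDl /rinner BA (AB (B x)).
have h1 := rinner_le (A x) (A y) ltr01; have h2 := rinner_le (B x) (B y) ltr01.
rewrite invr1 !mul1r in h1 h2.
have [hx|hx] := leP s (sqnorm (A x) + sqnorm (B x)); first by exists x.
by exists y; [rewrite y1|lra].
Qed.

End OperatorNorm.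

Theorem theorem2p16 (R : realType) (H : hilbertType R)
    (H_nontrivial : exists x : H, x != 0)
    (A : {linear H -> H}) (A_bounded : bounded_op A) :
  (numerical_radius A = 2^-1 * opnorm A <->
   circular_disk0 (2^-1 * opnorm A) (numerical_range A))
  /\
  (let S := fun x : H => adjoint A (A x) + A (adjoint A x) in
   numerical_radius A = 2^-1 * Num.sqrt (opnorm S) <->
   circular_disk0 (2^-1 * Num.sqrt (opnorm S)) (numerical_range A)).
Proof.
have [C AC] := bounded_op_sqnorm A_bounded.
have [B AB] := exists_adjoint AC.
split.
  split=> [wE|]; last first.
    exact: circular_disk0_radius.
  rewrite -wE.
  apply: (circular_disk0_numerical_range H_nontrivial A_bounded AB).
  set w := numerical_radius A in wE * => w0 e e0.
  (* The slack e / (4 w) fits the tangent bound |Ax|^2 >= 4 w |Ax| - 4 w^2, which yields |Ax|^2 > 4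
     w^2 - e. *)
  have [|x x1 xe] := @opnorm_approx _ _ A (2 * w - e / (4 * w)).
    by rewrite wE mulrA divff// mul1r ltrBlDr ltrDl -wE divr_gt0// mulr_gt0.
  exists x => //; rewrite sqnormE.
  have h : 4 * w * (2 * w - e / (4 * w)) < 4 * w * rnorm (A x).
    by rewrite ltr_pM2l// mulr_gt0.
  have hE : 4 * w * (2 * w - e / (4 * w)) = 8 * w ^+ 2 - e.
    by field; rewrite gt_eqF.
  have := sqr_ge0 (rnorm (A x) - 2 * w); have := sqnorm_ge0 (B x); lra.
move=> S.
have SE : S = fun x => B (A x) + A (B x).
  have adjE y : adjoint A y = B y by apply: adjoint_unique => x; exact: AB.
  by apply: funext => x; rewrite /S !adjE.
split=> [wE|]; last first.
  exact: circular_disk0_radius.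
rewrite -wE.
  apply: (circular_disk0_numerical_range H_nontrivial A_bounded AB).
(* Here 4 w^2 is exactly [opnorm S], which is nonnegative, so squaring undoes the root. *)
move=> w0 e e0; apply: (opnorm_gram_approx AB); rewrite -SE.
rewrite wE exprMn sqr_sqrtr ?opnorm_ge0// exprVn mulrA.
rewrite -[4]/(2 * 2)%:R natrM -expr2.
by rewrite divff ?mul1r ?ltrBlDr ?ltrDl// expf_eq0.
Qed.
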